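(* Let $a(z)=\sum_{i=-m}^{n}a_iz^i$ be a Laurent polynomial with complex coefficients, $m,n>0$, $a_{-m}\neq 0$, $a_n\ne 0$, and let $E=(e_{i,j})_{i,j\ge 1}$ be a semi-infinite complex matrix with $e_{i,j}=0$ whenever $i>k_1$ or $j>k_2$. Let $\Omega$ be any connected component of $\mathbb C\setminus a(\mathbb T)$, where $\mathbb T$ is the unit circle, and let $p=m+\mathrm{wind}(a-\lambda)$ for $\lambda\in\Omega$ (this is independent of $\lambda\in\Omega$). Assume that $p\ge 1$ and that the matrix $W$ defined in the context has at least $p$ rows. For $\lambda\in\Omega$ let $\Phi_F(\lambda)$ be the $p\times p$ matrix $WU(\lambda)$ if $W$ has exactly $p$ rows, and the $p\times p$ matrix formed by the first $p$ rows of $WU(\lambda)$ if $W$ has more than $p$ rows, where $U(\lambda)$ is the matrix defined in the context. Then the function $f_F(\lambda)=\det\Phi_F(\lambda)$ is holomorphic for $\lambda\in\Omega$.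
   Context: For a Laurent polynomial $b$ without zeros on $\mathbb T$, $\mathrm{wind}(b)$ is the winding number about $0$ of the curve $t\mapsto b(e^{\mathfrak i t})$, $t\in[0,2\pi]$. For $\lambda\in\Omega$, the number of zeros (counted with multiplicity) of $a(z)-\lambda$ of modulus less than $1$ is $p=m+\mathrm{wind}(a-\lambda)$. The matrix $U(\lambda)$ (Frobenius version): for $\lambda\in\Omega$, let $\xi_1,\ldots,\xi_p$ be the zeros of $a(z)-\lambda$ of modulus less than $1$, counted with multiplicity, and let $s(z)=\prod_{j=1}^p(z-\xi_j)=z^p+\sum_{i=0}^{p-1}s_iz^i$. Let $F$ be the $p\times p$ companion matrix $F=Z_p-\bm e_p[s_0,s_1,\ldots,s_{p-1}]$, where $Z_p$ is the $p\times p$ matrix with ones in positions $(i,i+1)$ and zeros elsewhere, and $\bm e_p=[0,\ldots,0,1]^T\in\mathbb R^p$. Put $G=F^p$ and let $U(\lambda)$ be the $\infty\times p$ matrix obtained by stacking the blocks $I,G,G^2,G^3,\ldots$ vertically. The matrix $W$: let $q=\max(m,k_1)$. Let $B$ be the $m\times m$ upper triangular Toeplitz matrix with first row $(a_{-m},a_{-m+1},\ldots,a_{-1})$. Let $E_1$ be the $m\times\infty$ matrix formed by the first $m$ rows of $E$, and, if $q>m$, let $E_2$ be the $(q-m)\times\infty$ matrix formed by rows $m+1,\ldots,q$ of $E$. If $q=m$, set $W=[-B\;\; E_1]$ (first $m$ columns given by $-B$, subsequent columns those of $E_1$). If $q>m$, let $r_2=\mathrm{rank}(E_2)$, fix a rank-revealing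 QR factorization $E_2=Q\begin{bmatrix}\widetilde R\\0\end{bmatrix}$ with $Q$ unitary of size $q-m$ and $\widetilde R$ of size $r_2\times\infty$ and rank $r_2$, and set $$W=\begin{bmatrix}-B&E_1\\0_{r_2\times m}&\widetilde R\end{bmatrix},$$ which has $m+r_2$ rows. $W$ does not depend on $\lambda$ and has only finitely many nonzero columns, so $WU(\lambda)$ is well defined. *)

(* Defs.v *)
From HB Require Import structures.
From mathcomp Require Import all_boot all_order all_algebra.
From mathcomp Require Import all_classical all_reals all_analysis.
From mathcomp Require Export complex.

Set Implicit Arguments.
Unset Strict Implicit.
Unset Printing Implicit Defensive.

Import Order.TTheory GRing.Theory Num.Theory.
Import numFieldNormedType.Exports.

Local Open Scope classical_set_scope.
Local Open Scope ring_scope.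

(* R[i] carries no canonical topology; its alias R[i]^o does (the one induced
   by the modulus, which is a normed module structure over R[i] itself). *)

(* The sets used below are open, so holomorphy is complex differentiability
   at each point.  The direction 1 : R[i] makes [derivable] the existence of the
   limit of (f (z + h) - f z) / h as the complex number h tends to 0. *)
Definition holomorphic_on (R : realType) (f : R[i] -> R[i]) (A : set R[i]) :=
  forall z, A z -> derivable (f : R[i]^o -> R[i]^o) z 1.

Definition unit_circle (R : realType) : set R[i] := [set z | `|z| = 1].
Arguments unit_circle : clear implicits.

Definition is_component (R : realType) (A Omega : set R[i]) :=
  exists2 x : R[i]^o, A x & Omega = connected_component (A : set R[i]^o) x.

Definition expi (R : realType) (t : R) : R[i] := (cos t +i* sin t)%C.

(* phi is a continuous determination of the argument of b (e^{it}) on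
   [0, 2 pi]. *)
Definition is_arg_along_circle (R : realType) (b : R[i] -> R[i]) (phi : R -> R) :=
  {within `[0, 2 * pi], continuous phi} /\
  forall t : R, 0 <= t <= 2 * pi -> b (expi t) = `|b (expi t)| * expi (phi t).

Definition wind (R : realType) (b : R[i] -> R[i]) : int :=
  xget 0 [set w : int | exists2 phi : R -> R, is_arg_along_circle b phi &
                          phi (2 * pi) - phi 0 = 2 * pi * w%:~R].

(* The Laurent polynomial \sum_(-m <= i <= n) a i * z ^ i; the values of a
   outside [-m, n] are irrelevant. *)
Definition laurent (R : realType) (m n : nat) (a : int -> R[i]) (z : R[i]) : R[i] :=
  \sum_(k < (m + n).+1) a (k%:Z - m%:Z) * z ^ (k%:Z - m%:Z).

(* z^m (a(z) - lambda) as an ordinary polynomial. When a_{-m} != 0 and 0 < m it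
   does not vanish at 0, so its zeros are those of a(z) - lambda, with the same
   multiplicities. *)
Definition numer (R : realType) (m n : nat) (a : int -> R[i]) (lambda : R[i]) :
    {poly R[i]} :=
  \sum_(k < (m + n).+1) a (k%:Z - m%:Z) *: 'X^k - lambda *: 'X^m.

(* closed_field_poly_normal gives the list of all zeros of a polynomial,
   repeated according to multiplicity. *)
Definition inner_zeros (R : realType) (m n : nat) (a : int -> R[i])
    (lambda : R[i]) : seq R[i] :=
  [seq x <- sval (closed_field_poly_normal (numer m n a lambda)) | `|x| < 1].

Definition inner_poly (R : realType) (m n : nat) (a : int -> R[i])
    (lambda : R[i]) : {poly R[i]} :=
  \prod_(x <- inner_zeros m n a lambda) ('X - x%:P).

(* Z_p - e_p [s_0, ..., s_(p-1)] *)
Definition Fmx (R : realType) (p : nat) (s : {poly R[i]}) : 'M[R[i]]_p :=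
  \matrix_(i, j) (i.+1 == j :> nat)%:R
  - (\col_i (i.+1 == p :> nat)%:R) *m (\row_j s`_j).

(* Semi-infinite matrices are 0-indexed: the entry (i, j) here is the entry
   (i + 1, j + 1) in the usual 1-based numbering. *)

Definition Umx (R : realType) (m n : nat) (a : int -> R[i]) (p : nat)
    (p_gt0 : (0 < p)%N) (lambda : R[i]) : nat -> 'I_p -> R[i] :=
  fun k j => ((Fmx p (inner_poly m n a lambda) ^+ p) ^+ (k %/ p)%N)
               (Ordinal (ltn_pmod k p_gt0)) j.

Definition Bmx (R : realType) (m : nat) (a : int -> R[i]) : 'M[R[i]]_m :=
  \matrix_(i, j) if (i <= j)%N then a (- m%:Z + (j - i)%N%:Z) else 0.

(* Rank of a matrix with r rows and infinitely many columns: the dimension of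
   its column space, attained on finitely many columns. *)
Definition inf_rank (R : realType) (r : nat) (A : 'I_r -> nat -> R[i]) : nat :=
  \max_(k < r.+1 | `[< exists N, \rank (\matrix_(i < r, j < N) A i j) = k >]) k.

Definition E2mx (R : realType) (m k1 : nat) (E : nat -> nat -> R[i]) :
    'I_(maxn m k1 - m) -> nat -> R[i] :=
  fun i j => E (m + i)%N j.
Arguments E2mx [R] m k1 E _ _.

(* [T; 0], completed with zero rows to a matrix with d rows *)
Definition pad_rows (R : realType) (d r : nat) (T : 'I_r -> nat -> R[i]) :
    'I_d -> nat -> R[i] :=
  fun i j => if insub (i : nat) is Some i' then T i' j else 0.

Definition rank_revealing_QR (R : realType) (d : nat) (A : 'I_d -> nat -> R[i])
    (r : nat) (Q : 'M[R[i]]_d) (T : 'I_r -> nat -> R[i]) :=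
  [/\ r = inf_rank A,
      Q \is unitarymx,
      inf_rank T = r
    & forall i j, A i j = \sum_(k < d) Q i k * pad_rows T k j].

(* [-B E_1; 0 T]. When max(m, k1) = m, the matrix E2mx has no rows, hence
   r2 = 0 and this is [-B E_1]. *)
Definition Wmx (R : realType) (m : nat) (a : int -> R[i])
    (E : nat -> nat -> R[i]) (r2 : nat) (T : 'I_r2 -> nat -> R[i]) :
    'I_(m + r2) -> nat -> R[i] :=
  fun i j =>
    match fintype.split i with
    | inl i1 => if insub j is Some j1 then - Bmx m a i1 j1 else E i1 (j - m)%N
    | inr i2 => if (j < m)%N then 0 else T i2 (j - m)%N
    end.

(* The first p rows of W U(lambda). The sum over all k : nat is finitary: W has
   finitely many nonzero columns. *)
Definition PhiF (R : realType) (m n : nat) (a : int -> R[i])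
    (E : nat -> nat -> R[i]) (r2 : nat) (T : 'I_r2 -> nat -> R[i])
    (p : nat) (p_gt0 : (0 < p)%N) (hW : (p <= m + r2)%N) (lambda : R[i]) :
    'M[R[i]]_p :=
  \matrix_(i, j) \sum_(k \in [set: nat])
    Wmx a E T (widen_ord hW i) k * Umx m n a p_gt0 lambda k j.

(* Main.v *)
Require Import Defs.
From HB Require Import structures.
From mathcomp Require Import all_boot all_order all_algebra.
From mathcomp Require Import all_classical all_reals all_analysis.
From mathcomp Require Import ring.

(* Everything reduces to the holomorphy of the coefficients of the inner factor
   s(lambda).  Dividing z^m (a(z) - lambda) by a_n splits it as s v, where s
   carries the zeros of modulus less than 1 and v the other ones.  Near a point
   lambda0 outside a(T), write f = s(lambda0), g = v(lambda0), so that
   s v = f g + delta z^m with delta = - (lambda - lambda0) / a_n.  The zeros of v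
   are bounded and stay away from those of f, hence v is invertible modulo f with
   a bounded inverse, and s = O(delta) modulo f; symmetrically v = O(delta)
   modulo g.  Since s and v are monic and their degrees add up to m + n, this
   forces deg s = deg f and deg v = deg g, so that s - f and v - g are O(delta).
   Multiplying by the inverse of g modulo f then gives a first order expansion of
   s with an O(delta^2) remainder. *)

Set Implicit Arguments.
Unset Strict Implicit.
Unset Printing Implicit Defensive.

Import Order.TTheory GRing.Theory Num.Theory.
Import numFieldNormedType.Exports.

Local Open Scope classical_set_scope.
Local Open Scope ring_scope.

(** * The [l^1] norm of the coefficients of a polynomial *)

Definition norm1 (K : numDomainType) (p : {poly K}) : K :=
  \sum_(i < size p) `|p`_i|.

Lemma norm1_ge0 (K : numDomainType) (p : {poly K}) : 0 <= norm1 p.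
Proof. exact: sumr_ge0. Qed.

Lemma norm1_widen (K : numDomainType) (p : {poly K}) (k : nat) :
  (size p <= k)%N -> norm1 p = \sum_(i < k) `|p`_i|.
Proof.
move=> pk; rewrite /norm1 (big_ord_widen k (fun i => `|p`_i|)) //.
rewrite big_mkcond /=; apply: eq_bigr => i _; case: ltnP => // /(nth_default 0) ->.
by rewrite normr0.
Qed.

Lemma norm10 (K : numDomainType) : norm1 (0 : {poly K}) = 0.
Proof. by rewrite /norm1 size_poly0 big_ord0. Qed.

Lemma norm1D (K : numDomainType) (p q : {poly K}) :
  norm1 (p + q) <= norm1 p + norm1 q.
Proof.
pose k := maxn (size p) (size q).
rewrite (norm1_widen (size_polyD p q)) (norm1_widen (leq_maxl _ _ : _ <= k)%N).
rewrite (norm1_widen (leq_maxr _ _ : _ <= k)%N) -big_split ler_sum // => i _.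
by rewrite coefD ler_normD.
Qed.

Lemma norm1Z (K : numDomainType) (c : K) (p : {poly K}) :
  norm1 (c *: p) = `|c| * norm1 p.
Proof.
rewrite (norm1_widen (size_scale_leq c p)) mulr_sumr.
by apply: eq_bigr => i _; rewrite coefZ normrM.
Qed.

Lemma norm1N (K : numDomainType) (p : {poly K}) : norm1 (- p) = norm1 p.
Proof. by rewrite -scaleN1r norm1Z normrN1 mul1r. Qed.

Lemma norm1_sum (K : numDomainType) (I : Type) (r : seq I) (F : I -> {poly K}) :
  norm1 (\sum_(i <- r) F i) <= \sum_(i <- r) norm1 (F i).
Proof.
elim/big_ind2: _ => [|x x' y y' hx hy|//]; first by rewrite norm10.
by rewrite (le_trans (norm1D _ _)) ?lerD.
Qed.

Lemma coef_le_norm1 (K : numDomainType) (p : {poly K}) (k : nat) :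
  `|p`_k| <= norm1 p.
Proof.
have [pk|kp] := leqP (size p) k.
  by rewrite nth_default // normr0 norm1_ge0.
by rewrite /norm1 (bigD1 (Ordinal kp)) //= lerDl sumr_ge0.
Qed.

Lemma norm1MXaddC (K : numDomainType) (p : {poly K}) (c : K) :
  norm1 (p * 'X + c%:P) = norm1 p + `|c|.
Proof.
have h : (size (p * 'X + c%:P)%R <= (size p).+1)%N.
  by rewrite size_MXaddC; case: ifP.
rewrite (norm1_widen h) big_ord_recl addrC; congr (_ + _).
  by apply: eq_bigr => i _; rewrite coefD coefMX coefC /= addr0.
by rewrite coefD coefMX coefC add0r.
Qed.

Lemma norm1MX (K : numDomainType) (p : {poly K}) : norm1 (p * 'X) = norm1 p.
Proof. by rewrite -[p * 'X]addr0 -polyC0 norm1MXaddC normr0 addr0. Qed.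

Lemma norm1Xn (K : numDomainType) (k : nat) : norm1 ('X^k : {poly K}) = 1.
Proof.
elim: k => [|k IH]; last by rewrite exprSr norm1MX.
by rewrite expr0 /norm1 size_poly1 big_ord1 coef1 normr1.
Qed.

(** Horner induction on [p]: multiplication by ['X] preserves the norm and a constant term only
    scales [q]. *)
Lemma norm1M (K : numDomainType) (p q : {poly K}) :
  norm1 (p * q) <= norm1 p * norm1 q.
Proof.
elim/poly_ind: p => [|p c IHp]; first by rewrite mul0r norm10 mul0r.
rewrite norm1MXaddC !mulrDl (le_trans (norm1D _ _)) // lerD //.
  by rewrite mulrAC norm1MX.
by rewrite mul_polyC norm1Z.
Qed.

(** * Reduction modulo a fixed polynomial, with uniform constants *)

Lemma norm1_modp_le (K : numFieldType) (f : {poly K}) (d : nat) :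
  exists2 C, 0 <= C &
    forall p : {poly K}, (size p <= d)%N -> norm1 (p %% f) <= C * norm1 p.
Proof.
(* Reduction modulo [f] is linear, so on polynomials of bounded size it is controlled by the images
   of the monomials. *)
exists (\sum_(i < d) norm1 ('X^i %% f)) => [|p pd].
  by apply: sumr_ge0 => i _; apply: norm1_ge0.
rewrite (norm1_widen pd) mulr_suml.
have -> : p %% f = \sum_(i < d) p`_i *: ('X^i %% f).
  rewrite [in LHS](_ : p = \sum_(i < d) p`_i *: 'X^i).
    elim/big_ind2: _ => [|x x' y y' <- <-|i _]; first by rewrite mod0p.
      by rewrite modpD.
    by rewrite modpZl.
  rewrite -{1}[p]coefK poly_def (big_ord_widen d (fun i => p`_i *: 'X^i)) //.
  rewrite big_mkcond /=; apply: eq_bigr => i _.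
  by case: ltnP => // /(nth_default 0) ->; rewrite scale0r.
apply: (le_trans (norm1_sum _ _)); apply: ler_sum => i _.
rewrite norm1Z mulrC ler_wpM2l ?norm1_ge0 //.
rewrite (bigD1 i) //= lerDl; exact: sumr_ge0.
Qed.

(** Synthetic division by ['X - y], done by induction on [f] so that one constant serves all [y] in
    a disc. In the inductive step [C * M + |c|] bounds the value and [C + C] the quotient [h * 'X +
    f.[y]]. *)
Lemma divp_XsubC_bound (K : numFieldType) (f : {poly K}) (M : K) :
  0 <= M -> exists2 C, 0 <= C & forall y, `|y| <= M ->
    `|f.[y]| <= C /\ exists h : {poly K},
      [/\ f = h * ('X - y%:P) + f.[y]%:P, (size h <= size f)%N & norm1 h <= C].
Proof.
move=> M0; elim/poly_ind: f => [|f c [C C0 IH]].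
  exists 0 => // y _; rewrite horner0 normr0; split=> //; exists 0.
  by rewrite mul0r addr0 size_poly0 norm10.
exists (C * M + `|c| + (C + C)) => [|y yM].
  by rewrite !addr_ge0 ?mulr_ge0.
have [fy [h [fE hf hC]]] := IH y yM.
rewrite hornerMXaddC; split.
  rewrite (le_trans (ler_normD _ _)) // normrM.
  apply: (@le_trans _ _ (C * M + `|c|)); last by rewrite lerDl addr_ge0.
  by rewrite lerD2r ler_pM.
exists (h * 'X + f.[y]%:P); split.
- rewrite {1}fE polyCD polyCM; ring.
- have [f0|f0] := eqVneq f 0.
    have : size h = 0%N by move: hf; rewrite f0 size_poly0 leqn0 => /eqP.
    move/eqP; rewrite size_poly_eq0 => /eqP ->.
    by rewrite f0 horner0 mul0r addr0 size_poly0.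
  rewrite !size_MXaddC (negPf f0) /=; case: ifP => // _; exact: hf.
- rewrite norm1MXaddC; apply: (@le_trans _ _ (C + C)); first exact: lerD.
  by rewrite lerDr addr_ge0 ?mulr_ge0.
Qed.

(* Modulo [f] the inverse of ['X - y] is [- h / f.[y]], where [h] is the quotient
   of [f - f.[y]] by ['X - y]. *)
Lemma modp_XsubC_bound (K : numFieldType) (f : {poly K}) (M c : K) :
  0 <= M -> 0 < c ->
  exists2 C, 0 <= C & forall y (g : {poly K}), `|y| <= M -> c <= `|f.[y]| ->
    norm1 (g %% f) <= C * norm1 ((('X - y%:P) * g) %% f).
Proof.
move=> M0 c0; have [H H0 hH] := divp_XsubC_bound f M0.
(* Both factors of the product [h * r] reduced below have size at most [size f]. *)
have [D D0 hD] := norm1_modp_le f (size f + size f).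
exists (c^-1 * (D * H)) => [|y g yM cy]; first by rewrite !mulr_ge0 // invr_ge0 ltW.
have [_ [h [fE hf hC]]] := hH y yM.
set r := (_ * g) %% f; pose v := f.[y].
have v0 : v != 0 by rewrite -normr_gt0 (lt_le_trans c0).
have -> : g %% f = - v^-1 *: ((h * r) %% f).
  rewrite modp_mul mulrA -modpZl; have -> : h * ('X - y%:P) = f - v%:P.
    by apply/eqP; rewrite eq_sym subr_eq; apply/eqP.
  rewrite mulrBl scalerBr modpD scalerAr modp_mulr add0r.
  by rewrite mul_polyC -scaleNr scalerA opprK mulVf // scale1r.
rewrite norm1Z normrN normfV -mulrA ler_pM ?invr_ge0 ?norm1_ge0 //.
  by rewrite lef_pV2 ?posrE ?normr_gt0.
(* A remainder is shorter than its divisor only for a nonzero divisor; [f = 0] is excluded by the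
   lower bound [c] on the value at [y]. *)
have sr : (size r <= size f)%N.
  have [f0|f0] := eqVneq f 0; last by rewrite ltnW // ltn_modp.
  by move: cy; rewrite f0 horner0 normr0 => /(lt_le_trans c0); rewrite ltxx.
apply: (le_trans (hD _ _)).
  by rewrite (leq_trans (size_polyMleq _ _)) // (leq_trans (leq_pred _)) // leq_add.
rewrite -mulrA ler_wpM2l // (le_trans (norm1M _ _)) // ler_wpM2r ?norm1_ge0 //.
Qed.

(** The linear factors are cancelled one at a time, each at the cost of a bounded factor. *)
Lemma modp_prod_XsubC_bound (K : numFieldType) (f : {poly K}) (M c : K) (d : nat) :
  0 <= M -> 0 < c ->
  exists2 C, 0 <= C & forall (ys : seq K) (g : {poly K}), (size ys <= d)%N ->
    {in ys, forall y, `|y| <= M /\ c <= `|f.[y]|} ->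
    norm1 (g %% f) <= C * norm1 ((\prod_(y <- ys) ('X - y%:P) * g) %% f).
Proof.
move=> M0 c0; have [C C0 hC] := modp_XsubC_bound f M0 c0.
(* A constant that is at least 1 has monotone powers, so the exponent [size ys] can be replaced by
   the uniform [d]. *)
have C1 : 0 <= C + 1 by rewrite addr_ge0.
exists ((C + 1) ^+ d) => [|ys g sd hys]; first exact: exprn_ge0.
apply: (@le_trans _ _ ((C + 1) ^+ size ys *
    norm1 ((\prod_(y <- ys) ('X - y%:P) * g) %% f))); last first.
  by rewrite ler_wpM2r ?norm1_ge0 // ler_weXn2l // lerDr.
elim: ys {d sd} g hys => [|y ys IH] g hys.
  by rewrite big_nil mul1r expr0 mul1r.
rewrite big_cons /= exprS.
have [yM cy] := hys y (mem_head _ _).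
apply: (le_trans (IH _ _)); first by move=> z hz; apply: hys; rewrite inE hz orbT.
rewrite -mulrA mulrCA ler_wpM2l ?exprn_ge0 //.
apply: (le_trans (hC y _ yM cy)); rewrite -mulrA ler_wpM2r ?norm1_ge0 //.
by rewrite lerDl.
Qed.

(** * Stability of a coprime factorization under perturbation *)

Lemma factor_modp_bound (K : numFieldType) (f : {poly K}) (M c : K) (d m : nat) :
  0 <= M -> 0 < c ->
  exists2 C, 0 <= C & forall (delta : K) (ys : seq K) (g s : {poly K}),
    (size ys <= d)%N -> {in ys, forall y, `|y| <= M /\ c <= `|f.[y]|} ->
    s * \prod_(y <- ys) ('X - y%:P) = f * g + delta *: 'X^m ->
    norm1 (s %% f) <= C * `|delta|.
Proof.
move=> M0 c0; have [C C0 hC] := modp_prod_XsubC_bound f d M0 c0.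
exists (C * norm1 ('X^m %% f)) => [|delta ys g s sd hys sE].
  by rewrite mulr_ge0 ?norm1_ge0.
(* Once multiplied by the linear factors, [s] is congruent to [delta *: 'X^m] modulo [f]. *)
apply: (le_trans (hC ys s sd hys)).
by rewrite [_ * s]mulrC sE modpD modp_mulr add0r modpZl norm1Z -mulrA ler_wpM2l // mulrC.
Qed.

(** A monic [s] shorter than [f] is its own remainder, and its leading coefficient already
    contributes 1 to the norm. *)
Lemma monic_size_le (K : numFieldType) (f s : {poly K}) :
  s \is monic -> norm1 (s %% f) < 1 -> (size f <= size s)%N.
Proof.
move=> /monicP s1; case: leqP => // sf; rewrite modp_small // => sN.
have := coef_le_norm1 s (size s).-1; rewrite -/(lead_coef s) s1 normr1.
by move=> /le_lt_trans/(_ sN); rewrite ltxx.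
Qed.

Lemma monic_modp_same_size (K : fieldType) (f s : {poly K}) :
  f \is monic -> s \is monic -> size s = size f -> s %% f = s - f.
Proof.
move=> fm sm sf; rewrite -[in LHS](subrK f s) addrC modpD modpp add0r modp_small //.
have f0 : f != 0 by apply: monic_neq0.
have f_gt0 : (0 < size f)%N by rewrite size_poly_gt0.
rewrite -(prednK f_gt0) ltnS; apply/leq_sizeP => j; rewrite leq_eqVlt coefB.
move=> /orP[/eqP <-|].
  rewrite -{1}sf -!/(lead_coef _) (monicP fm) (monicP sm) subrr //.
rewrite prednK // => hj; rewrite !nth_default ?subrr ?sf //.
Qed.

(* Writing [s = f + S] and [v = g + V] for the perturbed factors, one has
   [S * v = delta X^m - f * V]; multiplying by the inverse [A] of [g] modulo [f]
   gives [S = delta A X^m - A S V] modulo [f], where [S] and [V] are [O(delta)]. *)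
Lemma factor_expansion (K : numFieldType) (f g : {poly K}) (m : nat) (M c c' : K) :
  f \is monic -> g \is monic -> coprimep f g -> 0 <= M -> 0 < c -> 0 < c' ->
  exists (D : {poly K}) (C e : K), 0 < e /\
    forall (delta : K) (xs ys : seq K), `|delta| < e ->
    let s := \prod_(x <- xs) ('X - x%:P) in
    let v := \prod_(y <- ys) ('X - y%:P) in
    (size s + size v = size f + size g)%N ->
    {in xs, forall x, `|x| <= M /\ c' <= `|g.[x]|} ->
    {in ys, forall y, `|y| <= M /\ c <= `|f.[y]|} ->
    s * v = f * g + delta *: 'X^m ->
    norm1 (s - f - delta *: D) <= C * `|delta| ^+ 2.
Proof.
move=> fm gm /Bezout_eq1_coprimepP[[B A] /= AB] M0 c0 c0'.
have [Cf Cf0 hf] := factor_modp_bound f (size f + size g) m M0 c0.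
have [Cg Cg0 hg] := factor_modp_bound g (size f + size g) m M0 c0'.
(* The size bound is the one needed for the error term [A * S * V]. *)
have [C C0 hC] := norm1_modp_le f (size A + size f + size g).
have e0 : 0 < (Cf + Cg + 1)^-1 by rewrite invr_gt0 ltr_wpDl // addr_ge0.
(* The threshold for [delta] makes [Cf * |delta|] and [Cg * |delta|] both less than 1, which is what
   [monic_size_le] requires. *)
exists ((A * 'X^m) %% f), (C * (norm1 A * Cf * Cg)), (Cf + Cg + 1)^-1; split => //.
move=> delta xs ys de.
set s := \prod_(x <- xs) _; set v := \prod_(y <- ys) _ => szE hxs hys svE.
have small : (Cf + Cg + 1) * `|delta| < 1.
  by rewrite -(@ltr_pM2l _ (Cf + Cg + 1)^-1) //
    mulrA mulVf ?mul1r ?mulr1 // gt_eqF // -invr_gt0.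
have xs_d : (size xs <= size f + size g)%N.
  by rewrite -szE size_prod_XsubC addSn leqW // leq_addr.
have ys_d : (size ys <= size f + size g)%N.
  by rewrite -szE (size_prod_XsubC ys) addnS leqW // leq_addl.
have sN : norm1 (s %% f) <= Cf * `|delta| by apply: (hf _ ys g).
have vN : norm1 (v %% g) <= Cg * `|delta|.
  by apply: (hg _ xs f) => //; rewrite mulrC [g * f]mulrC.
have sm : s \is monic by apply: monic_prod_XsubC.
have vm : v \is monic by apply: monic_prod_XsubC.
have fs : (size f <= size s)%N.
  apply: monic_size_le => //; apply: (le_lt_trans sN); apply: le_lt_trans small.
  by rewrite ler_wpM2r // -addrA lerDl addr_ge0.
have gv : (size g <= size v)%N.
  apply: monic_size_le => //; apply: (le_lt_trans vN); apply: le_lt_trans small.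
  by rewrite ler_wpM2r // addrAC lerDr addr_ge0.
(* Neither size can drop and their sum is fixed, so both are unchanged. *)
have sf : size s = size f.
  by apply/eqP; rewrite eqn_leq fs andbT -(leq_add2r (size v)) szE leq_add2l.
have vg : size v = size g.
  by apply/eqP; rewrite eqn_leq gv andbT -(leq_add2l (size s)) szE leq_add2r.
move: sN vN.
rewrite (monic_modp_same_size fm sm sf) (monic_modp_same_size gm vm vg) => sN vN.
pose S := s - f; pose V := v - g.
have SE : S = S %% f by rewrite /S -monic_modp_same_size // modp_id.
have SmE : S = delta *: ((A * 'X^m) %% f) - (A * S * V) %% f.
  (* Expand [S = (B * f + A * g) * S] and replace [g * S] by [delta *: 'X^m - f * V - S * V]. *)
  have S_eq : S = A * (delta *: 'X^m) - A * S * V + f * (B * S - A * V).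
    have -> : delta *: 'X^m = s * v - f * g by rewrite svE addrC addKr.
    rewrite -[LHS]mul1r -AB /S /V; ring.
  by rewrite {1}SE {1}S_eq modpD modp_mulr addr0 modpD modpN -scalerAr modpZl.
rewrite -/S SmE addrAC subrr add0r norm1N.
apply: (le_trans (hC _ _)).
  have szS : (size S <= size f)%N by rewrite SE ltnW // ltn_modp monic_neq0.
  have szV : (size V <= size g)%N.
    by rewrite /V -monic_modp_same_size // ltnW // ltn_modp monic_neq0.
  apply: (leq_trans (size_polyMleq _ _)); apply: (leq_trans (leq_pred _)).
  rewrite leq_add // (leq_trans (size_polyMleq _ _)) //.
  by rewrite (leq_trans (leq_pred _)) // leq_add2l.
rewrite -[leRHS]mulrA ler_wpM2l // (le_trans (norm1M _ _)) //.
rewrite (_ : _ * _ ^+ 2 = norm1 A * (Cf * `|delta|) * (Cg * `|delta|)); last by ring.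
rewrite ler_pM ?norm1_ge0 // (le_trans (norm1M _ _)) // ler_wpM2l ?norm1_ge0 //.
Qed.

(** * Location of roots, values at a point and coprimality *)

Lemma monic_root_bound (K : numFieldType) (p : {poly K}) (x : K) :
  p \is monic -> root p x -> `|x| <= norm1 p.
Proof.
move=> /monicP pm /rootP px.
have p1 : 1 <= norm1 p.
  by have := coef_le_norm1 p (size p).-1; rewrite -/(lead_coef p) pm normr1.
(* If [|x| <= 1], the leading coefficient alone suffices. Otherwise the equation is solved for the
   top power [x ^+ d.+1] and divided by [|x| ^+ d]. *)
have [x1|x1] := real_leP (normr_real x) (@real1 K); first exact: le_trans p1.
have [d sp] : exists d, size p = d.+2.
  case E : (size p) => [|[|d]]; last by exists d.
    by move: pm; rewrite /lead_coef E nth_default ?E // => /eqP; rewrite eq_sym oner_eq0.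
  have [c c0 pE] := size_poly1P p (introT eqP E).
  by move: px; rewrite pE hornerC => /eqP; rewrite (negPf c0).
have x0 : 0 < `|x| by rewrite (lt_trans _ x1).
have xd : x ^+ d.+1 = - \sum_(i < d.+1) p`_i * x ^+ i.
  apply/eqP; rewrite -addr_eq0 addrC; apply/eqP.
  move: px; rewrite horner_coef sp big_ord_recr /=.
  by move: pm; rewrite /lead_coef sp /= => ->; rewrite mul1r.
rewrite -(@ler_pM2r _ (`|x| ^+ d)) ?exprn_gt0 // -exprS -normrX xd normrN.
apply: (le_trans (ler_norm_sum _ _ _)).
apply: (@le_trans _ _ (\sum_(i < d.+1) `|p`_i| * `|x| ^+ d)).
  apply: ler_sum => i _; rewrite normrM normrX ler_wpM2l //.
  by rewrite ler_weXn2l ?(ltW x1) // -ltnS.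
rewrite -mulr_suml ler_wpM2r ?exprn_ge0 // /norm1 sp.
by rewrite [leRHS]big_ord_recr lerDl.
Qed.

(** Converts distances from [y] to the roots into a lower bound for the value at [y], as
    [factor_expansion] demands of its roots. *)
Lemma le_horner_prod_XsubC (K : numDomainType) (xs : seq K) (y : K)
    (F : K -> K) :
  {in xs, forall x, 0 <= F x <= `|y - x|} ->
  \prod_(x <- xs) F x <= `|(\prod_(x <- xs) ('X - x%:P)).[y]|.
Proof.
move=> hF; rewrite horner_prod normr_prod big_seq [leRHS]big_seq.
by apply: ler_prod => x /hF; rewrite hornerXsubC.
Qed.

Lemma coprimep_prod_XsubC (K : fieldType) (xs : seq K) (p : {poly K}) :
  {in xs, forall x, ~~ root p x} -> coprimep (\prod_(x <- xs) ('X - x%:P)) p.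
Proof.
move=> hx; rewrite big_seq; elim/big_ind: _ => [|u v hu hv|x /hx].
- exact: coprime1p.
- by rewrite coprimepMl hu.
- by rewrite coprimep_sym coprimep_XsubC.
Qed.

(** * Complex differentiability and its stability under matrix operations *)

Lemma derivable_quadratic (K : numFieldType) (f : K^o -> K^o) (z D C e : K) :
  0 < e -> (forall h, `|h| < e -> `|f (z + h) - f z - h * D| <= C * `|h| ^+ 2) ->
  derivable f z 1.
Proof.
move=> e0 hf; apply: (cvgP (D : K^o)); apply/cvgrPdist_le => eps eps0.
(* [C] may be zero or not even real, whereas [|C| + 1] is a legitimate divisor of [eps]. *)
have C1 : 0 < `|C| + 1 by rewrite ltr_wpDl.
near=> h.
have h0 : h != 0 by near: h; exact: nbhs_dnbhs_neq.
have he : `|h| < e by near: h; exact: (@dnbhs0_lt K K^o).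
have hC : `|h| < eps / (`|C| + 1).
  by near: h; apply: (@dnbhs0_lt K K^o); rewrite divr_gt0.
rewrite /= [h *: 1]mulr1 [h + z]addrC.
have -> : (D : K^o) - h^-1 *: (f (z + h) - f z) =
          - (h^-1 * (f (z + h) - f z - h * D)).
  by rewrite [h^-1 *: _]/GRing.scale /=; field.
rewrite normrN normrM normfV ler_pdivrMl ?normr_gt0 //.
apply: (le_trans (hf h he)); rewrite expr2 mulrA mulrC ler_wpM2l //.
rewrite ltr_pdivlMr // mulrC in hC.
(* The assumed estimate bounds a norm by [C * |h| ^+ 2], which forces [C * |h|] to be
   nonnegative. *)
have Cr : 0 <= C * `|h|.
  have := le_trans (normr_ge0 _) (hf h he).
  by rewrite expr2 mulrA pmulr_lge0 // normr_gt0.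
rewrite -(ger0_norm Cr) normrM normr_id.
by apply: le_trans (ltW hC); rewrite ler_wpM2r // lerDl.
Unshelve. all: by end_near. Qed.

Lemma derivable_prod (K : numFieldType) (I : Type) (r : seq I)
    (F : I -> K^o -> K^o) (z : K) :
  (forall i, derivable (F i) z 1) -> derivable (fun x => \prod_(i <- r) F i x : K^o) z 1.
Proof.
move=> hF; elim: r => [|i r IH].
  by under eq_fun do rewrite big_nil; exact: derivable_cst.
by under eq_fun do rewrite big_cons; exact: derivableM.
Qed.

Lemma derivable_big_sum (K : numFieldType) (I : Type) (r : seq I)
    (F : I -> K^o -> K^o) (z : K) :
  (forall i, derivable (F i) z 1) -> derivable (fun x => \sum_(i <- r) F i x : K^o) z 1.
Proof.
move=> hF; elim: r => [|i r IH].
  by under eq_fun do rewrite big_nil; exact: derivable_cst.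
by under eq_fun do rewrite big_cons; exact: derivableD.
Qed.

Lemma derivable_mx_mul (K : numFieldType) (m n p : nat) (A : K^o -> 'M[K]_(m, n))
    (B : K^o -> 'M[K]_(n, p)) (z : K) :
  (forall i j, derivable (fun x => A x i j : K^o) z 1) ->
  (forall i j, derivable (fun x => B x i j : K^o) z 1) ->
  forall i j, derivable (fun x => (A x *m B x) i j : K^o) z 1.
Proof.
move=> hA hB i j.
under eq_fun do rewrite mxE.
by apply: derivable_big_sum => k; exact: derivableM.
Qed.

Lemma derivable_mx_exp (K : numFieldType) (p d : nat) (A : K^o -> 'M[K]_p) (z : K) :
  (forall i j, derivable (fun x => A x i j : K^o) z 1) ->
  forall i j, derivable (fun x => (A x ^+ d) i j : K^o) z 1.
Proof.
move=> hA; elim: d => [|d IH] i j; first exact: derivable_cst.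
under eq_fun do rewrite exprS.
exact: derivable_mx_mul.
Qed.

Lemma derivable_det (K : numFieldType) (p : nat) (A : K^o -> 'M[K]_p) (z : K) :
  (forall i j, derivable (fun x => A x i j : K^o) z 1) ->
  derivable (fun x => \det (A x) : K^o) z 1.
Proof.
move=> hA; apply: derivable_big_sum => s.
apply: derivableM; first exact: derivable_cst.
by apply: derivable_prod => i; apply: hA.
Qed.

(** * The inner and outer factors of [numer] *)

Definition outer_zeros (R : realType) (m n : nat) (a : int -> R[i])
    (lambda : R[i]) : seq R[i] :=
  [seq x <- sval (closed_field_poly_normal (numer m n a lambda)) | ~~ (`|x| < 1)].

Definition outer_poly (R : realType) (m n : nat) (a : int -> R[i])
    (lambda : R[i]) : {poly R[i]} :=
  \prod_(x <- outer_zeros m n a lambda) ('X - x%:P).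

Lemma numerE (R : realType) (m n : nat) (a : int -> R[i]) (lambda : R[i]) :
  numer m n a lambda =
  \poly_(k < (m + n).+1) a (k%:Z - m%:Z) - lambda *: 'X^m.
Proof. by rewrite poly_def. Qed.

Lemma lead_coef_numer (R : realType) (m n : nat) (a : int -> R[i]) (lambda : R[i]) :
  (0 < n)%N -> a n%:Z != 0 -> lead_coef (numer m n a lambda) = a n%:Z.
Proof.
move=> n0 an; have anE : (m + n)%:Z - m%:Z = n%:Z by rewrite PoszD addrAC subrr add0r.
rewrite numerE lead_coefDl; first by rewrite lead_coef_poly ?anE.
rewrite size_poly_eq ?anE // size_polyN (leq_ltn_trans (size_scale_leq _ _)) //.
by rewrite size_polyXn ltnS -[ltnLHS]addn0 ltn_add2l.
Qed.

Lemma size_numer (R : realType) (m n : nat) (a : int -> R[i]) (lambda : R[i]) :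
  (0 < n)%N -> a n%:Z != 0 -> size (numer m n a lambda) = (m + n).+1.
Proof.
move=> n0 an; have anE : (m + n)%:Z - m%:Z = n%:Z by rewrite PoszD addrAC subrr add0r.
rewrite numerE size_polyDl; first by rewrite size_poly_eq ?anE.
rewrite size_poly_eq ?anE // size_polyN (leq_ltn_trans (size_scale_leq _ _)) //.
by rewrite size_polyXn ltnS -[ltnLHS]addn0 ltn_add2l.
Qed.

(** The two filters are complementary, zeros on the circle going to the outer factor, so the
    splitting is valid for every [lambda], even on the curve. *)
Lemma inner_outer_poly (R : realType) (m n : nat) (a : int -> R[i]) (lambda : R[i]) :
  (0 < n)%N -> a n%:Z != 0 ->
  numer m n a lambda =
  a n%:Z *: (inner_poly m n a lambda * outer_poly m n a lambda).
Proof.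
move=> n0 an; rewrite /inner_poly /outer_poly /inner_zeros /outer_zeros.
case: closed_field_poly_normal => r /= rE; rewrite {1}rE lead_coef_numer //.
by rewrite !big_filter (bigID (fun x => `|x| < 1)).
Qed.

Lemma root_numer_circle (R : realType) (m n : nat) (a : int -> R[i])
    (lambda x : R[i]) :
  `|x| = 1 -> root (numer m n a lambda) x -> laurent m n a x = lambda.
Proof.
move=> x1 /rootP; rewrite /numer !hornerE horner_sum => /eqP.
rewrite subr_eq0 => /eqP xE.
have x0 : x != 0 by rewrite -normr_gt0 x1.
apply: (mulIf (expf_neq0 m x0)); rewrite -xE /laurent mulr_suml.
apply: eq_bigr => k _; rewrite !hornerE -mulrA; congr (_ * _).
by rewrite exprnP -expfzDr // subrK.
Qed.

(** [factor_expansion] is applied with centre [lambda]. Continuity of the individual zeros is never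
    invoked: only the total degree and bounds on the zeros enter. *)
Lemma derivable_inner_poly (R : realType) (m n : nat) (a : int -> R[i])
    (lambda : R[i]) (k : nat) :
  (0 < n)%N -> a n%:Z != 0 ->
  (~` (laurent m n a @` unit_circle R)) lambda ->
  derivable ((fun l => (inner_poly m n a l)`_k) : R[i]^o -> R[i]^o) lambda 1.
Proof.
move=> n0 an nlam.
pose f := inner_poly m n a lambda; pose g := outer_poly m n a lambda.
have fm : f \is monic by apply: monic_prod_XsubC.
have gm : g \is monic by apply: monic_prod_XsubC.
have root_g x : root g x = (x \in outer_zeros m n a lambda).
  exact: root_prod_XsubC.
have inner_lt1 l x : x \in inner_zeros m n a l -> `|x| < 1.
  by rewrite mem_filter => /andP[].
have outer_ge1 l x : x \in outer_zeros m n a l -> 1 <= `|x|.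
  by rewrite mem_filter => /andP[]; rewrite real_leNgt ?normr_real ?real1.
(* Strictness holds at the centre because a zero on the circle would put [lambda] on the curve. *)
have outer_gt1 x : x \in outer_zeros m n a lambda -> 1 < `|x|.
  move=> hx; rewrite lt_def (outer_ge1 lambda) // andbT; apply/eqP => x1; apply: nlam.
  exists x; first exact: x1.
  apply: root_numer_circle => //.
  by rewrite inner_outer_poly // rootZ // rootM root_g hx orbT.
have fg : coprimep f g.
  apply: coprimep_prod_XsubC => x hx; rewrite -/g root_g; apply/negP => /outer_ge1 x1.
  by have := lt_le_trans (inner_lt1 _ _ hx) x1; rewrite ltxx.
(* By the triangle inequality, [c] bounds [|f|] from below where [|y| >= 1], and [c'] bounds [|g|]
   from below where [|y| <= 1]. *)
pose c := \prod_(x <- inner_zeros m n a lambda) (1 - `|x|).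
pose c' := \prod_(x <- outer_zeros m n a lambda) (`|x| - 1).
have c0 : 0 < c.
  by rewrite /c big_seq; apply: prodr_gt0 => x /inner_lt1; rewrite subr_gt0.
have c'0 : 0 < c'.
  by rewrite /c' big_seq; apply: prodr_gt0 => x /outer_gt1; rewrite subr_gt0.
(* For [|delta| < 1] this dominates the norm of [f * g + delta *: 'X^m], hence all of its roots. *)
pose M := norm1 (f * g) + 1.
have M0 : 0 <= M by rewrite addr_ge0 ?norm1_ge0.
have [D [C [e [e0 hD]]]] := factor_expansion m fm gm fg M0 c0 c'0.
have an0 : 0 < `|a n%:Z| by rewrite normr_gt0.
(* The quotient [e / (e + 1)] is below both [e] and 1, and the factor [|a n|] turns a bound on
   [delta] into one on [h]. *)
pose e1 := `|a n%:Z| * (e * (e + 1)^-1).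
have e1e : 0 < e * (e + 1)^-1 by rewrite divr_gt0 // addr_gt0.
apply: (@derivable_quadratic _ _ _ (- (a n%:Z)^-1 * D`_k) (C * `|a n%:Z|^-1 ^+ 2) e1).
  by rewrite mulr_gt0.
move=> h; rewrite /e1 -ltr_pdivrMl // mulrC => he.
(* Moving [lambda] by [h] changes [numer] by [- h *: 'X^m]; the factors are monic, so this is
   divided by the leading coefficient. *)
pose delta := - h / a n%:Z.
have dE : `|delta| = `|h| / `|a n%:Z| by rewrite normrM normrN normfV.
rewrite -dE in he.
have d_lt_e : `|delta| < e.
  rewrite (lt_le_trans he) // ler_pdivrMr ?addr_gt0 //.
  by rewrite mulrDr mulr1 lerDr mulr_ge0 // ltW.
have d_lt_1 : `|delta| < 1.
  by rewrite (lt_le_trans he) // ler_pdivrMr ?addr_gt0 // mul1r lerDl.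
pose s := inner_poly m n a (lambda + h); pose v := outer_poly m n a (lambda + h).
have svE : s * v = f * g + delta *: 'X^m.
  apply: (scalerI an); rewrite -inner_outer_poly // scalerDr -inner_outer_poly //.
  rewrite scalerA /delta mulrC divfK // !numerE scalerDl scaleNr opprD.
  by rewrite addrA.
have svm : s * v \is monic by rewrite monicMl // monic_prod_XsubC.
have bound x : root (s * v) x -> `|x| <= M.
  move=> /(monic_root_bound svm) /le_trans; apply; rewrite svE.
  apply: (le_trans (norm1D _ _)); rewrite lerD2l norm1Z.
  by rewrite norm1Xn mulr1 ltW.
have := hD delta (inner_zeros m n a (lambda + h)) (outer_zeros m n a (lambda + h)) d_lt_e.
rewrite -/(inner_poly _ _ _ _) -/(outer_poly _ _ _ _) -/s -/v.
move=> /(_ _ _ _ svE) H.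
apply: le_trans (_ : norm1 (s - f - delta *: D) <= _).
  apply: le_trans (coef_le_norm1 _ k); rewrite !coefB coefZ /delta.
  by rewrite (_ : h * _ = - h / a n%:Z * D`_k); last by rewrite !mulNr mulrN mulrA.
have -> : C * `|a n%:Z|^-1 ^+ 2 * `|h| ^+ 2 = C * `|delta| ^+ 2.
  by rewrite dE exprMn -mulrA; congr (_ * _); exact: mulrC.
have s_v_sizes l : (size (inner_poly m n a l) + size (outer_poly m n a l))%N = (m + n).+2.
  have := size_numer m l n0 an; rewrite inner_outer_poly // size_scale //.
  rewrite size_Mmonic ?monic_neq0 ?monic_prod_XsubC // => <-.
  by rewrite prednK // addn_gt0 size_poly_gt0 monic_neq0 ?monic_prod_XsubC.
apply: H.
- by rewrite /f /g /s /v !s_v_sizes.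
- move=> x hx; split; first by apply: bound; rewrite rootM root_prod_XsubC hx.
  apply: le_horner_prod_XsubC => y /outer_gt1 y1.
  rewrite subr_ge0 ltW //= distrC (le_trans _ (lerB_dist _ _)) //.
  by rewrite lerD2l lerN2 ltW // (inner_lt1 _ _ hx).
- move=> y hy; split; first by apply: bound; rewrite rootM orbC root_prod_XsubC hy.
  apply: le_horner_prod_XsubC => x /inner_lt1 x1.
  rewrite subr_ge0 ltW //= (le_trans _ (lerB_dist _ _)) //.
  by rewrite lerD2r (outer_ge1 _ _ hy).
Qed.

(** * Finite support of [Wmx] and holomorphy of the determinant *)

Lemma rank_revealing_QR_vanish (R : realType) (d r : nat) (A : 'I_d -> nat -> R[i])
    (Q : 'M[R[i]]_d) (T : 'I_r -> nat -> R[i]) (j : nat) :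
  rank_revealing_QR A Q T -> (forall i, A i j = 0) -> forall i, T i j = 0.
Proof.
move=> [rE Qu _ AE] A0 i.
(* Since [r <= d], the padding keeps every row of [T]. *)
have rd : (r <= d)%N.
  by rewrite rE /inf_rank; apply/bigmax_leqP => k _; rewrite -ltnS.
pose t : 'cV[R[i]]_d := \col_k pad_rows T k j.
have Qt : Q *m t = 0.
  apply/colP => l; rewrite !mxE -[RHS](A0 l) AE.
  by apply: eq_bigr => k _; rewrite mxE.
(* A zero column of [A] is [Q] times the padded column of [T], and the unitary [Q] is invertible. *)
have t0 : t = 0.
  by rewrite -[t]mul1mx -(mulmx1C (unitarymxP Qu)) -mulmxA Qt mulmx0.
by have /colP/(_ (widen_ord rd i)) := t0; rewrite !mxE /pad_rows /= valK.
Qed.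

(** The block [-B] fills the first [m] columns; after the shift by [m], the columns of [E] vanish
    from [k2] on, and those of [T] vanish with them. *)
Lemma Wmx_finite_support (R : realType) (m k1 k2 : nat) (a : int -> R[i])
    (E : nat -> nat -> R[i]) (r2 : nat) (Q : 'M[R[i]]_(maxn m k1 - m))
    (T : 'I_r2 -> nat -> R[i]) :
  (forall i j : nat, (k1 <= i)%N || (k2 <= j)%N -> E i j = 0) ->
  rank_revealing_QR (E2mx m k1 E) Q T ->
  forall (i : 'I_(m + r2)) j, (m + k2 <= j)%N -> Wmx a E T i j = 0.
Proof.
move=> E0 QR i j hj; have mj : (m <= j)%N := leq_trans (leq_addr _ _) hj.
have kj : (k2 <= j - m)%N by rewrite leq_subRL.
rewrite /Wmx; case: fintype.split => i'.
  by rewrite insubN -?leqNgt // E0 // kj orbT.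
rewrite ltnNge mj /=; apply: (rank_revealing_QR_vanish QR) => l.
by rewrite /E2mx E0 // kj orbT.
Qed.

Lemma derivable_Umx (R : realType) (m n : nat) (a : int -> R[i]) (p : nat)
    (p_gt0 : (0 < p)%N) (lambda : R[i]) (k : nat) (j : 'I_p) :
  (forall i, derivable ((fun l => (inner_poly m n a l)`_i) : R[i]^o -> R[i]^o) lambda 1) ->
  derivable ((fun l => Umx m n a p_gt0 l k j) : R[i]^o -> R[i]^o) lambda 1.
Proof.
move=> hs; apply: derivable_mx_exp; apply: derivable_mx_exp => u v.
under eq_fun do rewrite !mxE.
apply: derivableB; first exact: derivable_cst.
apply: derivable_big_sum => w; under eq_fun do rewrite !mxE.
by apply: derivableM; [exact: derivable_cst|exact: hs].
Qed.

Theorem theorem4p2 (R : realType) (m n : nat) (a : int -> R[i])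
  (k1 k2 : nat) (E : nat -> nat -> R[i])
  (Omega : set R[i]) (p : nat)
  (r2 : nat) (Q : 'M[R[i]]_(maxn m k1 - m)) (T : 'I_r2 -> nat -> R[i])
  (m_gt0 : (0 < m)%N) (n_gt0 : (0 < n)%N)
  (a_m_neq0 : a (- m%:Z) != 0) (a_n_neq0 : a n%:Z != 0)
  (E_supp : forall i j : nat, (k1 <= i)%N || (k2 <= j)%N -> E i j = 0)
  (Omega_comp : is_component (~` (laurent m n a @` unit_circle R)) Omega)
  (p_def : exists2 lambda, Omega lambda &
             p%:Z = m%:Z + wind (fun z => laurent m n a z - lambda))
  (p_gt0 : (0 < p)%N)
  (QR : rank_revealing_QR (E2mx m k1 E) Q T)
  (p_le : (p <= m + r2)%N) :
  holomorphic_on (fun lambda => \det (PhiF n a E T p_gt0 p_le lambda)) Omega.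
Proof.
move=> lambda; case: Omega_comp => x _ -> /connected_component_sub nlam.
apply: derivable_det => i j.
(* The finitary sum over all indices becomes a sum over a range independent of [l], which can be
   differentiated termwise. *)
have -> : (fun l => PhiF n a E T p_gt0 p_le l i j) =
    (fun l => \sum_(k < m + k2) Wmx a E T (widen_ord p_le i) k * Umx m n a p_gt0 l k j).
  apply/funext => l; rewrite mxE -(fsbig_widen `I_(m + k2)) -?fsbig_ord // => k [_ /= hk].
  by rewrite (Wmx_finite_support a E_supp QR) ?mul0r // leqNgt; apply/negP.
apply: derivable_big_sum => k; apply: derivableM; first exact: derivable_cst.
by apply: derivable_Umx => l; apply: derivable_inner_poly.
Qed.
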